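(* Let $G$ be a finite group, $\mathfrak{F}$ a solubly saturated formation containing the class $\mathfrak{N}$ of all finite nilpotent groups, and $E$ a normal subgroup of $G$ with $G/E\in\mathfrak{F}$. Suppose that every subgroup of $F^*(E)$ of prime order is contained in $Z_\infty(G)$ and that every cyclic subgroup of $F^*(E)$ of order $4$ (this being required only when the Sylow $2$-subgroups of $F^*(E)$ are not quaternion-free) satisfies partial $\Pi$-property in $G$. Then $G\in\mathfrak{F}$.
   Context: All groups are finite. For a positive integer $n$ and a set of primes $\pi$, $n$ is a $\pi$-number if all its prime divisors lie in $\pi$ (so $1$ is a $\pi$-number for every $\pi$, including $\pi=\emptyset$); $\pi(H)$ is the set of prime divisors of $|H|$. Partial $\Pi$-property: a subgroup $H$ of $G$ satisfies partial $\Pi$-property in $G$ if there exists a chief series $1=G_0<G_1<\cdots<G_n=G$ of $G$ such that for every $1\leq i\leq n$, the index $|G/G_{i-1}:N_{G/G_{i-1}}(HG_{i-1}/G_{i-1}\cap G_i/G_{i-1})|$ is a $\pi(HG_{i-1}/G_{i-1}\cap G_i/G_{i-1})$-number. A group is quaternion-free if it has no section isomorphic to the quaternion group of order $8$. A formation is a class of groups closed under homomorphic images and subdirect products. A formation $\mathfrak{F}$ is solubly saturated if $G\in\mathfrak{F}$ whenever $G/\Phi(N)\in\mathfrak{F}$ for some solvable normal subgroup $N$ of $G$. $F^*(E)$ is the generalized Fitting subgroup of $E$, i.e. its quasinilpotent radical (largest normal quasinilpotent subgroup). $Z_\infty(G)$ is the hypercentre of $G$ (the last term of the upper central series). *)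

(* Defs.v *)
From mathcomp Require Import all_boot all_fingroup all_solvable.

Set Implicit Arguments.
Unset Strict Implicit.
Unset Printing Implicit Defensive.

Import GroupScope.

Definition group_class := forall gT : finGroupType, {group gT} -> Prop.

(* Invariance under isomorphism is the case of an injective f. *)
Definition image_closed (FF : group_class) : Prop :=
  forall (gT rT : finGroupType) (G : {group gT}) (f : {morphism G >-> rT}),
    FF gT G -> FF rT (f @* G)%G.

(* H is a subdirect product of its two projections; subdirect products of   *)
(* more factors are obtained by iteration, up to isomorphism.               *)
Definition subdirect_closed (FF : group_class) : Prop :=
  forall (gT1 gT2 : finGroupType) (H : {group gT1 * gT2}),
    FF gT1 ([morphism of fst] @* H)%G ->
    FF gT2 ([morphism of snd] @* H)%G -> FF (gT1 * gT2)%type H.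

Definition formation (FF : group_class) : Prop :=
  image_closed FF /\ subdirect_closed FF.

Definition solubly_saturated (FF : group_class) : Prop :=
  forall (gT : finGroupType) (G N : {group gT}),
    N <| G -> solvable N -> FF _ (G / 'Phi(N))%G -> FF gT G.

Definition contains_nilpotent (FF : group_class) : Prop :=
  forall (gT : finGroupType) (G : {group gT}), nilpotent G -> FF gT G.

Section GroupNotions.

Variable gT : finGroupType.
Implicit Types (G H A B U V N : {group gT}) (s : seq {group gT}).

(* G induces only inner automorphisms on each of its chief factors U / V.   *)
Definition quasinilpotent G : bool :=
  [forall U : {group gT}, forall V : {group gT},
    chief_factor G V U ==>
    [forall x in G / V, exists h in U / V,
      [forall y in U / V, y ^ x == y ^ h]]].

(* The product of two normal quasinilpotent subgroups is quasinilpotent, so *)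
(* the join below is the largest normal quasinilpotent subgroup of G.       *)
Definition gen_Fitting G : {group gT} :=
  (\prod_(N : {group gT} | (N <| G) && quasinilpotent N) N)%G.

(* The upper central series is stationary from the index #|G| on: see       *)
(* ucn_sub_hypercentre.                                                     *)
Definition hypercentre G : {group gT} := ('Z_#|G|(G))%G.

Definition quaternion_free G : bool :=
  [forall A : {group gT}, forall B : {group gT},
    (A \subset G) && (B <| A) ==> ~~ (A / B \isog 'Q_8)].

(* The series is 1 :: s, so V and U are its i-th and (i+1)-st terms. *)
Definition partial_Pi G H : Prop :=
  exists s,
    [/\ (G.-chief).-series 1%G s, last 1%G s = G
      & forall i, i < size s ->
        let V := nth 1%G (1%G :: s) i in
        let U := nth 1%G s i in
        \pi((H * V) / V :&: U / V).-nat
          #|G / V : 'N_(G / V)((H * V) / V :&: U / V)|].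

Lemma ucn_sub_hypercentre G n : 'Z_n(G) \subset hypercentre G.
Proof.
have stab k m : 'Z_k(G) = 'Z_k.+1(G) -> k <= m -> 'Z_m(G) = 'Z_k(G).
  move=> eqZ /subnK <-; elim: (m - k) => [|j IHj] //.
  by rewrite addSn ucnSn IHj -ucnSn.
have grow k : (exists2 j, j <= k & 'Z_j(G) = 'Z_j.+1(G)) \/ k < #|'Z_k.+1(G)|.
  elim: k => [|k [[j lejk eqZ] | ltkZ]]; first by right; apply: cardG_gt0.
    by left; exists j; first exact: leqW.
  have [/eqP eqZ | neqZ] := boolP ('Z_k.+1(G) == 'Z_k.+2(G)).
    by left; exists k.+1.
  right; apply: leq_ltn_trans ltkZ _; apply: proper_card.
  by rewrite properEneq neqZ ucn_subS.
have [[j lejG eqZ] | ] := grow #|G|; last first.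
  by rewrite ltnNge subset_leq_card ?ucn_sub.
have [lenG | ltGn] := leqP n #|G|; first exact: ucn_sub_geq.
by rewrite /= (stab j n) ?(stab j #|G|) // (leq_trans lejG) // ltnW.
Qed.

End GroupNotions.

(* Main.v *)
Require Import Defs.
From mathcomp Require Import all_boot all_fingroup all_solvable ssralg zmodp.

Set Implicit Arguments.
Unset Strict Implicit.
Unset Printing Implicit Defensive.

Import GroupScope.

(* The hypotheses force F*(E) to lie in the hypercentre Z of G.  If Q is a    *)
(* p-subgroup with p odd, a p'-element normalising Q and centralising its     *)
(* elements of order p centralises Q; so in a normal quasinilpotent subgroup  *)
(* of E every Sylow subgroup of odd order controls its own fusion, transfer   *)
(* makes that subgroup solvable, and F*(E) = F(E).  If the p'-elements of G   *)
(* do not centralise P = O_p(F(E)), let R <= P be a minimal normal subgroup   *)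
(* of G that they do not centralise, and let T be its subgroup of elements    *)
(* that they centralise.  Then T <= Z(R), R / T is elementary abelian, and R  *)
(* has exponent p, or 4 when p = 2.  So p = 2 and R contains an element a of  *)
(* order 4 outside T.  The partial Pi-property of <a> would make the chief    *)
(* factor covered by a central, against R = [R, O^2(G)]; and a together with  *)
(* a conjugate a^x, x of odd order, generates a group with quotient Q_8.      *)
(* Since C_E(F*(E)) <= F*(E) <= Z, the group E is nilpotent, hence E <= Z.    *)
(* Finally G is recovered from G / E through central extensions by groups of  *)
(* prime order p, each being obtained by soluble saturation after             *)
(* amalgamating with a cyclic group of order p ^ 2.                           *)

(** * Central extensions in solubly saturated formations *)

(** The aim is to place E in the hypercentre of G, after which [formation_hypercentral_ext] lifts
    membership in FF from G / E to G. Two facts translate between hypercentrality and coprime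
    action: p-elements of the hypercentre commute with all p'-elements ([hypercentre_commute]), and
    a normal p-subgroup centralised by all p'-elements is hypercentral
    ([normal_pgroup_hypercentre]).

    Commutation is extended from the elements of order p to a whole normal p-subgroup by
    [odd_p'_commute] and, with the conditions on order 4, by [two_p'_commute]; both study a minimal
    counterexample R. The odd case also supplies Frobenius's condition to [Frobenius_der1_proper],
    whence [odd_prime_hypercentral_sol] and F*(E) = F(E). Both cases together make F(E)
    hypercentral, and [gen_Fitting_hypercentral] passes from F(E) to E by means of
    [cent_gen_Fitting]. *)

Lemma cyclic_group_exists n : 0 < n ->
  exists (aT : finGroupType) (c : aT), #[c] = n /\ abelian [set: aT].
Proof.
case: n => // n _; exists 'I_n.+1, (Zp1 : 'I_n.+1).
split; first exact: order_Zp1.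
by apply/centsP=> x _ y _; apply: Zp_mulgC.
Qed.

Section Formations.

Variable FF : group_class.
Hypothesis formF : formation FF.

(** The map x |-> (f x, g x) sends K onto a subdirect product of the two images, and h factors
    through that map. *)
Lemma formation_image_pair (gT rT1 rT2 rT : finGroupType) (K : {group gT})
    (f : {morphism K >-> rT1}) (g : {morphism K >-> rT2})
    (h : {morphism K >-> rT}) :
  FF (f @* K)%G -> FF (g @* K)%G -> 'ker f :&: 'ker g \subset 'ker h ->
  FF (h @* K)%G.
Proof.
have [imF subF] := formF => Ff Fg skfg.
have phiM : {in K &, {morph (fun x => (f x, g x)) : x y / x * y}}.
  by move=> x y Kx Ky; rewrite /= !morphM.
pose phi := Morphism phiM.
have skphi : 'ker phi \subset 'ker h.
  apply: subset_trans skfg; apply/subsetP=> x /morphpreP[Kx].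
  by rewrite inE => /eqP[fx gx]; rewrite inE; apply/andP; split; apply/kerP.
have FH : FF (phi @* K)%G.
  apply: subF.
    suff -> : ([morphism of fst] @* (phi @* K))%G = (f @* K)%G by [].
    apply: val_inj; rewrite /= !morphimEsub ?subsetT //.
    by rewrite -imset_comp; apply: eq_imset.
  suff -> : ([morphism of snd] @* (phi @* K))%G = (g @* K)%G by [].
  apply: val_inj; rewrite /= !morphimEsub ?subsetT //.
  by rewrite -imset_comp; apply: eq_imset.
have := imF _ _ _ (factm_morphism skphi (subxx K)) FH.
by congr FF; apply: val_inj; rewrite /= morphim_factm.
Qed.

Lemma formation_isog (gT rT : finGroupType) (G : {group gT}) (H : {group rT}) :
  FF G -> G \isog H -> FF H.
Proof.
move=> FG /isogP[f _ fG].
by have := formF.1 _ _ _ f FG; congr FF; apply: val_inj.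
Qed.

Hypothesis satF : solubly_saturated FF.
Hypothesis nilF : contains_nilpotent FF.

Lemma formation_central_prime_ext (gT : finGroupType) (G N : {group gT}) :
  N \subset 'Z(G) -> prime #|N| -> FF (G / N)%G -> FF G.
Proof.
move=> sNZ; set p := #|N| => p_pr FGN.
have [z defN] := cyclicP (prime_cyclic p_pr).
have Nz : z \in N by rewrite defN cycle_id.
have [Gz cGz] := setIP (subsetP sNZ z Nz).
have zp : z ^+ p = 1 by rewrite /p defN expg_order.
have [aT [c [oc abT]]] := @cyclic_group_exists (p ^ 2) (ltac:(by rewrite
  expn_gt0 prime_gt0)).
pose P := [set: aT]%G; pose K := setX_group G P.
have nNG : G \subset 'N(N).
  by rewrite cents_norm // centsC (subset_trans sNZ) ?subsetIr.
(* K / D is the central product of G and <[c]> with N and <[c ^+ p]> merged   *)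
(* into 'Phi(S), so it is in FF by saturation; then K, a subdirect product of *)
(* K / D and <[c]>, is in FF, and it projects onto G.                         *)
pose c1 : gT * aT := (1, c); pose d : gT * aT := (z, c ^+ p); pose D := <[d]>.
have Kcent (u : gT) (v : aT) : u \in 'Z(G) -> (u, v) \in 'Z(K).
  case/setIP=> Gu cu; rewrite inE !inE /= Gu /=; apply/centP=> -[a b].
  rewrite !inE andbT /= => Ga; congr (_, _) => /=; first exact: (centP cu).
  by apply: (centsP abT); rewrite inE.
have Zd : d \in 'Z(K) by apply: Kcent; rewrite inE Gz cGz.
have Zc : c1 \in 'Z(K) by apply: Kcent; apply: group1.
have Kd := subsetP (center_sub K) d Zd; have Kc := subsetP (center_sub K) _ Zc.
have nsDK : D <| K by rewrite sub_center_normal ?cycle_subG.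
have nDK := normal_norm nsDK.
pose S := (<[c1]> / D)%G.
have nsSK : S <| K / D.
  by apply: quotient_normal; rewrite sub_center_normal ?cycle_subG.
have pairX (u : gT) (v : aT) k : (u, v) ^+ k = (u ^+ k, v ^+ k).
  by elim: k => // k IHk; rewrite !expgS IHk.
have pc : p.-group <[c1]>.
  rewrite /pgroup -orderE (@pnat_dvd _ (p ^ 2)) ?pnatX ?pnat_id // order_dvdn
    pairX.
  by rewrite expg1n -{1}oc expg_order.
have pS : p.-group S by apply: quotient_pgroup.
have fM : {in K &, {morph (fun x => coset N x.1) : x y / x * y}}.
  move=> x y; rewrite !inE !andbT => Gx Gy.
  by rewrite /= morphM // (subsetP nNG).
have nc v : v \in 'N(<[c ^+ p]>).
  by apply: (subsetP (cents_norm _)) (in_setT v);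
    rewrite (sub_abelian_cent2 abT) ?subsetT.
have gC x y : commute (coset <[c ^+ p]> x) (coset <[c ^+ p]> y).
  by rewrite /commute -!morphM //; congr (coset _ _); apply: (centsP abT);
    rewrite inE.
have gM : {in K &, {morph (fun x => coset <[c ^+ p]> x.2) : x y / x * y}}.
  by move=> x y _ _; rewrite /= morphM.
have nPhi : K / D \subset 'N('Phi(S)).
  exact: normal_norm (gFnormal_trans _ nsSK).
have hM : {in K &, {morph (fun x => coset 'Phi(S) (coset D x)) : x y / x * y}}.
  move=> x y Kx Ky; rewrite !morphM ?(subsetP nDK) //.
    by rewrite (subsetP nPhi) ?mem_quotient.
  by rewrite (subsetP nPhi) ?mem_quotient.
have FKD : FF (K / D)%G.
  apply: satF nsSK _ _.
    by apply/abelian_sol/quotient_abelian/cycle_abelian.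
  have -> : (K / D / 'Phi(S) = Morphism hM @* K)%G.
    apply: val_inj; rewrite /= [RHS]morphimEdom; apply/setP=> y.
    apply/morphimP/imsetP=> [[w _ /morphimP[x _ Kx def_w] ->] | [x Kx ->]].
      by exists x; rewrite ?def_w.
    exists (coset D x) => //; last by rewrite mem_quotient.
    by apply: (subsetP nPhi); rewrite mem_quotient.
  (* The common kernel of f and g consists of the pairs in N x [<[c ^+ p]>], and is generated by d
     and [c1 ^+ p]: the former dies modulo D, the latter becomes a p-th power in S, hence lies in
     ['Phi(S)]. *)
  apply: (formation_image_pair (f := Morphism fM) (g := Morphism gM)).
  - suff -> : (Morphism fM @* K = G / N)%G by [].
    apply: val_inj; rewrite /= [LHS]morphimEdom; apply/setP=> y.
    apply/imsetP/morphimP=> [[x] | [x nx Gx ->]].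
      rewrite !inE andbT => Gx ->; exists x.1 => //; exact: (subsetP nNG).
    by exists (x, 1); rewrite // !inE Gx.
  - apply: nilF; apply: abelian_nil; rewrite /= morphimEdom.
    by apply/centsP=> _ /imsetP[x _ ->] _ /imsetP[y _ ->]; apply: gC.
  have kd : d \in 'ker (Morphism hM).
    by apply/kerP => //=; rewrite (coset_id (cycle_id d)) morph1.
  have kc : c1 ^+ p \in 'ker (Morphism hM).
    apply/kerP => /=; first exact: groupX.
    apply: coset_id; rewrite morphX ?(subsetP nDK) //.
    rewrite (Phi_joing pS); apply: (subsetP (joing_subr _ _)).
    apply: (Mho_p_elt 1); first by rewrite mem_quotient ?cycle_id.
    by apply: mem_p_elt pS _; rewrite mem_quotient ?cycle_id.
  apply/subsetP=> -[u v] /setIP[/morphpreP[Kuv fu] /morphpreP[_ gv]].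
  have Gu : u \in G by move: Kuv; rewrite !inE andbT.
  have: u \in N by rewrite -(ker_coset N); apply/kerP;
    [apply: (subsetP nNG) | apply/set1P].
  rewrite defN => /cycleP[i ui].
  have: v \in <[c ^+ p]>.
    by rewrite -(ker_coset <[c ^+ p]>%G); apply/kerP; [apply: nc | apply/set1P].
  case/cycleP=> j vj.
  have -> : (u, v) = d ^+ i * (c1 ^+ p) ^- i * (c1 ^+ p) ^+ j.
    rewrite !pairX ui vj !expg1n; congr (_, _) => /=;
      last by rewrite mulgV mul1g.
    by rewrite invg1 !mulg1.
  have mem_L (L : {group gT * aT}) : d \in L -> c1 ^+ p \in L ->
    d ^+ i * (c1 ^+ p) ^- i * (c1 ^+ p) ^+ j \in L.
    move=> Ld Lc; apply: groupM (groupX _ Lc); apply: groupM (groupX _ Ld) _.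
    by apply/groupVr/groupX.
  exact: mem_L.
have defG : ([morphism of fst] @* K = restrm (subsetT K) [morphism of fst] @*
  K)%G.
  by apply: val_inj; rewrite /= morphim_restrm setIid.
have <- : ([morphism of fst] @* K = G)%G.
  by apply: val_inj; rewrite /= morphim_fstX.
rewrite defG.
apply: (formation_image_pair (f := restrm nDK [morphism of coset D])
          (g := restrm (subsetT K) [morphism of snd])).
- suff -> : (restrm nDK [morphism of coset D] @* K = K / D)%G by [].
  by apply: val_inj; rewrite /= morphim_restrm setIid.
- apply/nilF/abelian_nil/(abelianS (subsetT _)); exact: abT.
rewrite !ker_restrm; apply/subsetP=> -[u v] /setIP[/setIP[Kuv]].
rewrite ker_coset => /cycleP[k]; rewrite pairX =>
  -[uk vk] /setIP[_ /mker /= v1].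
apply/setIP; split=> //; apply/kerP; rewrite ?inE //= uk.
(* D meets G x 1 trivially: as c has order p ^ 2, [c ^+ (p * k) = 1] forces p to divide k, and then
   [z ^+ k = 1]. *)
have: p ^ 2 %| p * k by rewrite -oc order_dvdn expgM -vk -v1.
by rewrite dvdn_pmul2l ?prime_gt0 // => /dvdnP[l ->];
  rewrite mulnC expgM zp expg1n.
Qed.

(** Central subgroups of prime order are peeled off E. If ['Z_k.+1(G)] is the first term of the
    upper central series to meet E nontrivially, that intersection is central, since its commutators
    with G lie in [E :&: 'Z_k(G) = 1]. *)
Lemma formation_hypercentral_ext (gT : finGroupType) (G E : {group gT}) :
  E <| G -> E \subset hypercentre G -> FF (G / E)%G -> FF G.
Proof.
have [n] := ubnP #|E|; elim: n gT G E =>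
  // n IHn gT G E /ltnSE-leEn nsEG sEZ FGE.
have [E1 | ntE] := eqVneq (E : {set gT}) 1.
  apply: formation_isog FGE _; rewrite /= E1 isog_sym; exact: quotient1_isog.
have [k [tiEk ntEk]] : exists k, E :&: 'Z_k(G) = 1 /\ E :&: 'Z_k.+1(G) != 1.
  have: exists k, E :&: 'Z_k(G) != 1 by exists #|G|; rewrite (setIidPl sEZ).
  case/ex_minnP=> -[|k] ntEk mink; first by rewrite ucn0 setIg1 eqxx in ntEk.
  by exists k; split=> //; apply/eqP; apply: contraT => /mink; rewrite ltnn.
have sEZ1 : E :&: 'Z_k.+1(G) \subset 'Z(G).
  rewrite subsetI subIset ?(normal_sub nsEG) //=; apply/commG1P/trivgP;
    rewrite -tiEk subsetI.
  rewrite (subset_trans (commSg _ (subsetIl _ _))) ?commg_subl ?normal_norm //=.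
  exact: subset_trans (commSg _ (subsetIr _ _)) (ucn_comm _ _).
pose p := pdiv #|E :&: 'Z_k.+1(G)|.
have p_pr : prime p by rewrite pdiv_prime // cardG_gt1.
have [x Ex ox] := Cauchy p_pr (pdiv_dvd _).
pose N := <[x]>%G; have sNE : N \subset E :&: 'Z_k.+1(G) by rewrite cycle_subG.
have pN : prime #|N| by rewrite -orderE ox.
have sNZ := subset_trans sNE sEZ1.
have nsNG := sub_center_normal sNZ.
have [sNE' _] := subsetIP sNE; have nsNE := normalS sNE' (normal_sub nsEG) nsNG.
apply: (formation_central_prime_ext sNZ pN).
apply: (IHn _ (G / N)%G (E / N)%G).
- apply: leq_trans leEn.
  by rewrite ltn_quotient // -cardG_gt1 prime_gt1.
- exact: quotient_normal.
- apply: subset_trans (quotientS _ sEZ) _;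
  apply: subset_trans (ucn_sub_hypercentre _ #|G|).
  exact: morphim_ucn.
by apply: formation_isog FGE _; rewrite isog_sym third_isog.
Qed.

End Formations.

(** * Hypercentre *)

Section Commuting.

Variable gT : finGroupType.
Implicit Types (G H K P R T : {group gT}).

(** With t = [[~ a, x]] fixed by x, conjugating a by [x ^+ k] gives [a * t ^+ k]; taking k = [#[x]]
    shows that the order of t divides that of x, to which it is coprime. *)
Lemma coprime_comm_fixed pi (a x : gT) :
  pi.-elt [~ a, x] -> pi^'.-elt x -> commute [~ a, x] x -> commute a x.
Proof.
move=> pi_t pi_x ctx; apply/commgP.
have tx : [~ a, x] ^ x = [~ a, x] by rewrite [LHS]conjgE ctx mulKg.
have axk k : a ^ (x ^+ k) = a * [~ a, x] ^+ k.
  elim: k => [|k IHk]; first by rewrite conjg1 mulg1.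
  by rewrite (expgSr x) conjgM IHk conjMg conjXg tx (conjg_mulR a) expgS -mulgA.
have := axk #[x]; rewrite expg_order conjg1 => /esym/eqP.
rewrite -[X in _ == X]mulg1 (inj_eq (mulgI a)) -order_dvdn => dv.
rewrite -order_eq1; apply/eqP/(@pnat_1 pi) => //.
exact: pnat_dvd dv pi_x.
Qed.

Lemma ucn_subgroup n G H : H \subset G -> 'Z_n(G) :&: H \subset 'Z_n(H).
Proof.
move=> sHG; elim: n => [|n IHn]; first by rewrite !ucn0 subsetIl.
apply/subsetP=> x; rewrite !ucnSnR !inE => /andP[/andP[Gx sxG] Hx].
rewrite Hx /=; apply: subset_trans IHn; rewrite subsetI.
rewrite (subset_trans (commgS _ sHG)) //=.
by rewrite (subset_trans (commSg _ (_ : [set x] \subset H))) ?sub1set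
  ?commg_subl ?normG.
Qed.

Lemma hypercentre_subgroup G H : H \subset G ->
  hypercentre G :&: H \subset hypercentre H.
Proof. by move/(ucn_subgroup #|G|)=> sZ;
  apply: subset_trans sZ (ucn_sub_hypercentre _ _). Qed.

(** Induction up the upper central series inside the p-core of the hypercentre: for a in the next
    term, [[~ a, x]] is a p-element one term lower, so it commutes with x and [coprime_comm_fixed]
    applies. *)
Lemma hypercentre_commute G p (x y : gT) :
  y \in hypercentre G -> p.-elt y -> x \in G -> p^'.-elt x -> commute y x.
Proof.
move=> Zy py Gx px.
have nilZ : nilpotent (hypercentre G) by apply: ucn_nilpotent.
pose Q := 'O_p(hypercentre G).
have nsQG : Q <| G by apply: gFnormal_trans (ucn_normal _ _).
have pQ : p.-group Q by apply: pcore_pgroup.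
have Qy : y \in Q by rewrite (mem_normal_Hall (nilpotent_pcore_Hall p nilZ))
  ?pcore_normal.
suffices cQ n a : a \in Q -> a \in 'Z_n(G) -> commute a x by apply: cQ Qy Zy.
elim: n a => [|n IHn] a Qa.
  by rewrite ucn0 => /set1P->; apply/commute_sym/commute1.
move=> Za; have Qax : [~ a, x] \in Q.
  by rewrite commgEl groupM ?groupV // memJ_norm // (subsetP (normal_norm
    nsQG)).
apply: (coprime_comm_fixed (mem_p_elt pQ Qax) px).
by apply: IHn => //; rewrite (subsetP (ucn_comm n G)) // mem_commg.
Qed.

Lemma hypercentre_center1 G : 'Z(G / hypercentre G) = 1.
Proof.
apply/trivgP; rewrite /hypercentre /= -ucn_central quotient_sub1.
  exact: ucn_sub_hypercentre.
exact: subset_trans (ucn_sub _ _) (ucn_norm _ _).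
Qed.

Lemma all_Sylow_sub G H :
  (forall p, prime p -> exists2 S : {group gT}, p.-Sylow(G) S & S \subset H) ->
    G \subset H.
Proof.
move=> sylH; suffices <- : G :&: H = G by apply: subsetIr.
apply/eqP; rewrite eqEcard subsetIl dvdn_leq ?cardG_gt0 //.
apply/dvdn_partP=> // p; rewrite mem_primes => /andP[p_pr _].
have [S sylS sSH] := sylH p p_pr.
by rewrite -(card_Hall sylS) cardSg // subsetI (pHall_sub sylS).
Qed.

End Commuting.

Section Hypercentre.

Variable gT : finGroupType.
Implicit Types (G H K P R T : {group gT}).

(** Otherwise P has a nontrivial image modulo the hypercentre, which meets the centre of a Sylow
    p-subgroup there. An element in that intersection also commutes with the Sylow q-subgroups for q
    != p, so it is central, whereas the quotient has trivial centre. *)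
Lemma normal_pgroup_hypercentre G P (p : nat) :
  P <| G -> p.-group P ->
  (forall x, x \in G -> p^'.-elt x -> x \in 'C(P)) ->
  P \subset hypercentre G.
Proof.
move=> nsPG pP cPx; set Z := hypercentre G.
have nsZG : Z <| G by apply: ucn_normal.
have nZG := normal_norm nsZG.
rewrite -quotient_sub1 ?(subset_trans (normal_sub nsPG)) //.
rewrite -(hypercentre_center1 G); apply/idPn=> ntPZ.
have [S sylS] := Sylow_exists p G.
have sPS : P \subset S.
  by rewrite (subset_trans (pcore_max pP nsPG)) // pcore_sub_Hall.
have ntP : P / Z != 1 by apply: contraNneq ntPZ => ->; apply: sub1G.
have nsPS : P / Z <| S / Z.
  by apply/quotient_normal/(normalS sPS (pHall_sub sylS)).
have nilS : nilpotent (S / Z) by apply/pgroup_nil/quotient_pgroup/(pHall_pgroup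
  sylS).
case/negP: (meet_center_nil nilS nsPS ntP).
rewrite -subG1 -(hypercentre_center1 G).
apply/subsetP=> _ /setIP[/morphimP[y Ny Py ->] /setIP[_ cyS]].
rewrite inE mem_quotient ?(subsetP (normal_sub nsPG)) //=.
suffices /subsetP cGy : G / Z \subset 'C[coset Z y].
  by apply/centP=> z /cGy/cent1P; apply: commute_sym.
apply: all_Sylow_sub.
move=> q q_pr; have [-> | neq_qp] := eqVneq q p.
  exists (S / Z)%G; first exact: quotient_pHall (subset_trans (pHall_sub sylS)
    nZG) sylS.
  by rewrite sub_cent1.
have [T sylT] := Sylow_exists q G; exists (T / Z)%G.
  exact: quotient_pHall (subset_trans (pHall_sub sylT) nZG) sylT.
apply/subsetP=> _ /morphimP[x Nx Tx ->]; apply/cent1P.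
rewrite /commute -!morphM //; congr (coset _ _).
apply: (centP (cPx x _ _)) => //; first exact: (subsetP (pHall_sub sylT)).
apply: sub_in_pnat (mem_p_elt (pHall_pgroup sylT) Tx) => r _ /eqP->.
by rewrite !inE.
Qed.

End Hypercentre.

(** * Quasinilpotent groups *)

Section MinimalNormal.

Variable gT : finGroupType.
Implicit Types (E K S U : {group gT}).

(* K is generated by the E-conjugates of a minimal normal subgroup of K, and  *)
(* each of these is contained in U or meets it trivially.                     *)
Lemma minnormal_sub_join_cent E K U :
  minnormal K E -> K <| E -> U <| K -> K \subset U * 'C_K(U).
Proof.
move=> /mingroupP[/andP[ntK nKE] minK] nsKE nsUK.
have [S minS sSK] := minnormal_exists ntK (normG K).
have /mingroupP[/andP[ntS nSK] minSK] := minS.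
have nCU : 'C_K(U) \subset 'N(U) by rewrite subIset // cent_sub orbT.
rewrite -(norm_joinEr nCU).
pose J := <<class_support S E>>%G.
have sJK : J \subset K.
  by rewrite gen_subG class_support_sub_norm // normal_norm.
have <- : J :=: K.
  apply: minK => //; apply/andP; split; last first.
    by rewrite norms_gen // class_support_norm.
  by apply: contraNneq ntS => J1; rewrite -subG1 -[1]J1 sub_gen //
    sub_class_support.
rewrite gen_subG class_supportEr; apply/bigcupsP=> e Ee.
have Ke : K :^ e = K by apply: (normsP (normal_norm nsKE)).
have sSeK : S :^ e \subset K by rewrite -Ke conjSg.
have nSeK : K \subset 'N(S :^ e) by rewrite -Ke normJ conjSg.
have [tiSU | ntSU] := eqVneq (S :^ e :&: U) 1.
  apply: subset_trans (joing_subr _ _); rewrite subsetI sSeK /=.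
  apply/commG1P/trivgP; rewrite -tiSU subsetI.
  rewrite commg_subl (subset_trans (normal_sub nsUK)) //=.
  by rewrite commg_subr (subset_trans sSeK) // normal_norm.
apply: subset_trans (joing_subl _ _); apply/setIidPl.
have defS : (S :^ e :&: U) :^ e^-1 = S.
  apply: (minSK ((S :^ e :&: U) :^ e^-1)%G) => /=; last first.
    by rewrite sub_conjg invgK subsetIl.
  apply/andP; split.
    by apply: contraNneq ntSU => /(canRL (conjsgKV _)) /= ->; rewrite conjs1g.
  by rewrite /= normJ -sub_conjg Ke normsI // normal_norm.
by rewrite -[LHS](conjsgKV e) defS.
Qed.

End MinimalNormal.

Section Quasinilpotent.

Variable gT : finGroupType.
Implicit Types (E K N S U V Z : {group gT}).

(** An element u * c of K, with u in U and c in C, acts on U / V as u does, because C acts trivially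
    there. *)
Lemma chief_factor_cent_quasinil K :
  (forall U V, chief_factor K V U ->
     exists2 C : {group gT}, K \subset U * C & [~: U, C] \subset V) ->
  quasinilpotent K.
Proof.
move=> cfK; apply/forallP=> U; apply/forallP=> V; apply/implyP=> chUV.
have [C sKUC sUCV] := cfK U V chUV.
have /andP[/maxgroupP[/andP[/andP[sVU _] nVK] _] /andP[sUK nUK]] := chUV.
have nVU := subset_trans sUK nVK.
apply/forall_inP=> _ /morphimP[x nVx Kx ->].
have /mulsgP[u c Uu Cc def_x] := subsetP sKUC x Kx.
have Ku := subsetP sUK u Uu.
have nVu := subsetP nVK u Ku.
have nVc : c \in 'N(V) by rewrite -(groupMl _ nVu) -def_x.
apply/exists_inP; exists (coset V u); first exact: mem_quotient.
apply/forall_inP=> _ /morphimP[y nVy Uy ->].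
rewrite -!morphJ //; apply/eqP; rewrite def_x conjgM.
rewrite (conjg_mulR (y ^ u)) morphM ?groupJ //; last first.
  by rewrite groupR ?groupJ.
rewrite [X in _ * X]coset_id ?mulg1 // (subsetP sUCV) //.
by rewrite mem_commg // groupJ.
Qed.

(** A chief factor U / V of K with U inside V * Z is central. Otherwise [U :&: V * Z = V] by
    maximality of V, and [minnormal_sub_join_cent] in K / Z gives K = U * C with [[~: U, C]] inside
    [U :&: Z], hence inside V. *)
Lemma central_ext_quasinil E K Z :
  K <| E -> Z <| E -> Z \subset 'Z(K) -> minnormal (K / Z) (E / Z) ->
    quasinilpotent K.
Proof.
move=> nsKE nsZE sZZ minKZ; apply: chief_factor_cent_quasinil => U V chUV.
have /andP[/maxgroupP[/andP[/andP[sVU _] nVK] maxV] nsUK] := chUV.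
have [sUK nUK] := andP nsUK.
have [sZK cZK] := subsetIP sZZ.
have nZK : K \subset 'N(Z) by apply: subset_trans (normal_sub nsKE)
  (normal_norm nsZE).
have [sUVZ | not_sUVZ] := boolP (U \subset V * Z).
  exists K; first exact: mulG_subr.
  apply: subset_trans (commSg _ sUVZ) _.
  have nVZ := subset_trans sZK nVK.
  rewrite -quotient_cents2 //; last by rewrite mul_subG ?normG.
  by rewrite quotientMidl quotient_cents.
have UVZ : U :&: V * Z = V.
  have cVZ : commute V Z by apply/esym/normC; apply: subset_trans sZK nVK.
  rewrite -(comm_joingE cVZ).
  apply: (maxV (U :&: V <*> Z)%G) => /=; last by rewrite subsetI sVU joing_subl.
  rewrite normsI ?normsY // andbT; apply/andP; split; first exact: subsetIl.
  apply: contra not_sUVZ; rewrite subsetI => /andP[_].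
  by rewrite comm_joingE.
have sUCK : K / Z \subset U / Z * 'C_(K / Z)(U / Z).
  apply: minnormal_sub_join_cent minKZ _ _; exact: quotient_normal.
have [C defC sZC sCK] := inv_quotientS (normalS sZK (normal_sub nsKE) nsZE)
  (subsetIl (K / Z) 'C(U / Z)).
have nZC := subset_trans sCK nZK; have nZU := subset_trans sUK nZK.
exists C.
  move: sUCK; rewrite /= defC -quotientMl // quotientSK // =>
    /subset_trans-> //.
  by rewrite mulgA (normC (subset_trans sZK nUK)) -mulgA (mulSGid sZC) subxx.
have sUCZ : [~: U, C] \subset Z.
  rewrite -quotient_cents2 // centsC -defC; exact: subsetIr.
rewrite -UVZ subsetI (subset_trans sUCZ (mulG_subr _ _)) andbT.
by rewrite commg_subl (subset_trans sCK).
Qed.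

Lemma quasinil_sub_gen_Fitting E N : N <| E -> quasinilpotent N ->
  N \subset gen_Fitting E.
Proof.
by move=> nsNE qN; rewrite bigprodGE sub_gen // (bigcup_max N) ?nsNE.
Qed.

Lemma nilpotent_quasinil N : nilpotent N -> quasinilpotent N.
Proof.
move=> nilN; apply: chief_factor_cent_quasinil => U V chUV.
have := chief_factor_minnormal chUV.
have /andP[/maxgroupP[/andP[/andP[sVU _] nVK] _] nsUK] := chUV.
case/mingroupP=> /andP[ntUV _] minUV.
exists N; first exact: mulG_subr.
rewrite -quotient_cents2 ?(subset_trans (normal_sub nsUK)) //.
have := meet_center_nil (quotient_nil V nilN) (quotient_normal V nsUK) ntUV.
move=> ntI; have <- := minUV (U / V :&: 'Z(N / V))%G _ (subsetIl _ _).
  by rewrite subIset // subsetIr orbT.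
  rewrite ntI /=; apply: normsI (gFnorm _ _).
  by rewrite quotient_norms ?normal_norm.
Qed.

(** Chief factors are abelian, so their inner automorphisms are trivial and a chief series is
    central. *)
Lemma solvable_quasinil_nil N : solvable N -> quasinilpotent N -> nilpotent N.
Proof.
move=> solN /forallP qN.
have [s chs lasts] := chief_series_exists (normal_refl N).
apply: centrals_nil (lasts); apply: sub_path chs => V U /= chUV.
have /forallP/(_ V)/implyP/(_ chUV)/forall_inP inner := qN U.
have := minnormal_solvable (chief_factor_minnormal chUV) (quotientS _ _)
  (quotient_sol _ solN).
have /andP[/maxgroupP[/andP[/andP[sVU _] nVK] _] /andP[sUK nUK]] := chUV.
case/(_ sUK) => _ _ /is_abelemP[p _ /abelem_abelian abUV].
rewrite /central_factor sVU sUK !andbT.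
rewrite -quotient_cents2 ?(subset_trans sUK) //; apply/centsP=> y Uy x Nx.
have /exists_inP[h Uh /forall_inP/(_ y Uy)/eqP yx] := inner x Nx.
apply/commgP/conjg_fixP; rewrite yx; apply/conjg_fixP/commgP.
exact: (centsP abUV).
Qed.

End Quasinilpotent.

(** * The generalized Fitting subgroup and its centraliser *)

Section GeneralizedFitting.

Variable gT : finGroupType.
Implicit Types E : {group gT}.

(** If C were not inside F, a minimal normal subgroup K / (C :&: F) of E / (C :&: F) below C would
    have K centralising F, so K would be a central extension as in [central_ext_quasinil]. Being
    quasinilpotent and normal, K would then lie in F, making the factor trivial. *)
Lemma cent_gen_Fitting E :
  gen_Fitting E <| E -> 'C_E(gen_Fitting E) \subset gen_Fitting E.
Proof.
set F := gen_Fitting E => nsFE; set C := 'C_E(F).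
have nsCE : C <| E by rewrite /normal subsetIl normsI ?normG ?norms_cent
  ?normal_norm.
have nsZE : C :&: F <| E by apply: normalI.
apply/idPn=> not_sCF.
have ntC : C / (C :&: F) != 1.
  rewrite -subG1 quotient_sub1; last first.
    by rewrite (subset_trans (normal_sub nsCE)) ?(normal_norm nsZE).
  by rewrite subsetI subxx.
have [M minM sMC] := minnormal_exists ntC (quotient_norms (C :&: F)
  (normal_norm nsCE)).
have nsME : M <| E / (C :&: F).
  have /mingroupp/andP[_ nME] := minM.
  by rewrite /normal nME (subset_trans sMC) ?quotientS ?(normal_sub nsCE).
have [K defM sZK nsKE] := inv_quotientN nsZE nsME.
have sKC : K \subset C.
  rewrite -(quotientSGK _ (subsetIl C F)) -?defM //.
  exact: subset_trans (normal_sub nsKE) (normal_norm nsZE).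
have qK : quasinilpotent K.
  apply: (central_ext_quasinil nsKE nsZE); last by rewrite -defM.
  rewrite subsetI sZK centsC; apply: subset_trans sKC _.
  by apply: subset_trans (subsetIr _ _) (centS _); apply: subsetIr.
have /mingroupp/andP[/negP[]] := minM.
rewrite defM -subG1 quotient_sub1.
  by rewrite subsetI sKC quasinil_sub_gen_Fitting.
exact: subset_trans (normal_sub nsKE) (normal_norm nsZE).
Qed.

Lemma gen_Fitting_nil E :
  (forall N : {group gT}, N <| E -> quasinilpotent N -> nilpotent N) ->
  gen_Fitting E :=: 'F(E).
Proof.
move=> nilE; apply/eqP; rewrite eqEsubset; apply/andP; split.
  rewrite bigprodGE gen_subG; apply/bigcupsP=> N /andP[nsNE qN].
  exact: Fitting_max (nilE N nsNE qN).
apply: quasinil_sub_gen_Fitting; first exact: Fitting_normal.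
exact/nilpotent_quasinil/Fitting_nil.
Qed.

End GeneralizedFitting.

(** * Fusion and transfer *)

Section Frobenius.

Variables (gT : finGroupType) (p : nat) (H : {group gT}).
(** Frobenius's condition for p-nilpotence: ['N_H(D)] induces a p-group of automorphisms on D. *)
Hypothesis p'_cent : forall (D : {group gT}) x,
  D \subset H -> p.-group D -> x \in 'N_H(D) -> p^'.-elt x -> x \in 'C(D).

Lemma norm_cent_Sylow (D S : {group gT}) :
  D \subset H -> p.-group D -> p.-Sylow('N_H(D)) S ->
    'N_H(D) \subset 'C_H(D) * S.
Proof.
move=> sDH pD sylS.
have nCS : S \subset 'N('C_H(D)).
  apply: subset_trans (pHall_sub sylS) _.
  rewrite normsI ?norms_cent ?subsetIr //;
    apply: subset_trans (subsetIl _ _) (normG _).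
rewrite -norm_joinEr //; apply: all_Sylow_sub => q q_pr.
have [-> | neq_qp] := eqVneq q p; first by exists S; last exact: joing_subr.
have [T sylT] := Sylow_exists q 'N_H(D); exists T => //.
apply: subset_trans (joing_subl _ _); apply/subsetP=> x Tx.
have Nx := subsetP (pHall_sub sylT) x Tx.
have [Hx _] := setIP Nx; rewrite inE Hx /=; apply: p'_cent => //.
apply: sub_in_pnat (mem_p_elt (pHall_pgroup sylT) Tx) => r _ /eqP->.
by rewrite !inE.
Qed.

(* Downward induction on #|P :&: Q|, linking P to Q through Sylow subgroups   *)
(* that contain 'N_P(P :&: Q) and 'N_Q(P :&: Q).                              *)
Lemma Sylow_cent_conj (P Q : {group gT}) :
  p.-Sylow(H) P -> p.-Sylow(H) Q ->
  exists2 c, c \in 'C_H(P :&: Q) & Q :=: P :^ c.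
Proof.
have [n] := ubnP (#|P| - #|P :&: Q|); elim: n => // n IHn in P Q *.
move=> /ltnSE-le_n sylP sylQ; set D := P :&: Q.
have oPQ : #|Q| = #|P| by rewrite (card_Hall sylP) (card_Hall sylQ).
have pP := pHall_pgroup sylP; have pQ := pHall_pgroup sylQ.
have sPH := pHall_sub sylP; have sQH := pHall_sub sylQ.
have [sPQ | not_sPQ] := boolP (P \subset Q).
  exists 1; first exact: group1.
  by rewrite conjsg1; apply/esym/eqP; rewrite eqEcard sPQ oPQ leqnn.
have ltDP : D \proper P by rewrite properE subsetIl subsetI subxx.
have ltDQ : D \proper Q.
  rewrite properEcard subsetIr /= oPQ; exact: proper_card.
have sDH : D \subset H := subset_trans (proper_sub ltDP) sPH.
have pD : p.-group D := pgroupS (proper_sub ltDP) pP.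
have ltDNP := nilpotent_proper_norm (pgroup_nil pP) ltDP.
have ltDNQ := nilpotent_proper_norm (pgroup_nil pQ) ltDQ.
have [S sylS sNPS] := Sylow_superset (setSI 'N(D) sPH) (pgroupS (subsetIl _ _)
  pP).
have [T sylT sNQT] := Sylow_superset (setSI 'N(D) sQH) (pgroupS (subsetIl _ _)
  pQ).
have [m Nm defT] := Sylow_trans sylS sylT.
(* By [norm_cent_Sylow], m factors as s * c with s in S; since s normalises S, the centralising
   factor c alone carries S to T. *)
have [c Cc defTc] : exists2 c, c \in 'C_H(D) & T :=: S :^ c.
  have := subsetP (norm_cent_Sylow sDH pD sylS) m Nm.
  rewrite -normC; last first.
    apply: subset_trans (pHall_sub sylS) _.
    rewrite normsI ?norms_cent ?subsetIr //;
      apply: subset_trans (subsetIl _ _) (normG _).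
  by case/mulsgP=> s c Ss Cc def_m; exists c;
    rewrite // defT def_m conjsgM conjGid.
have [P1 sylP1 sSP1] := Sylow_superset (subset_trans (pHall_sub sylS) (subsetIl
  _ _)) (pHall_pgroup sylS).
have [Hc cDc] := setIP Cc.
have sylP1c : p.-Sylow(H) (P1 :^ c)%G by rewrite pHallJ.
have sNPI : 'N_P(D) \subset P :&: P1 by rewrite subsetI subsetIl (subset_trans
  sNPS).
have sNQI : 'N_Q(D) \subset P1 :^ c :&: Q.
  by rewrite subsetI subsetIl andbT (subset_trans sNQT) // defTc conjSg.
have [|a /setIP[Ha cDa] defP1] := IHn P P1 _ sylP sylP1.
  apply: leq_trans le_n; apply: ltn_sub2l; first exact: proper_card ltDP.
  exact: leq_trans (proper_card ltDNP) (subset_leq_card sNPI).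
have [|b /setIP[Hb cDb] defQ] := IHn (P1 :^ c)%G Q _ sylP1c sylQ.
  apply: leq_trans le_n; rewrite cardJg (card_Hall sylP1) -(card_Hall sylP).
  apply: ltn_sub2l; first exact: proper_card ltDP.
  exact: leq_trans (proper_card ltDNQ) (subset_leq_card sNQI).
have sDNP := subset_trans (proper_sub ltDNP) sNPI.
have sDNQ := subset_trans (proper_sub ltDNQ) sNQI.
exists (a * c * b); last by rewrite !conjsgM -defP1 -defQ.
rewrite inE !groupM //=; [exact: subsetP (centS sDNP) a cDa |
  exact: subsetP (centS sDNQ) b cDb].
Qed.

(** Since [x ^ g] lies in P and in [P :^ g], some c centralising it satisfies [P :^ g = P :^ c].
    Then [g * c^-1] normalises P, so it is an element of ['C_H(P)] times some u in P. *)
Lemma Sylow_control_fusion (P : {group gT}) x g :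
  p.-Sylow(H) P -> x \in P -> g \in H -> x ^ g \in P ->
  exists2 u, u \in P & x ^ g = x ^ u.
Proof.
move=> sylP Px Hg Pxg.
have sylPg : p.-Sylow(H) (P :^ g)%G by rewrite pHallJ.
have [c /setIP[Hc cPc] defPg] := Sylow_cent_conj sylP sylPg.
have cxg : (x ^ g) ^ c^-1 = x ^ g.
  apply/conjg_fixP/commgP/commuteV/commute_sym/(centP cPc).
  by rewrite inE Pxg memJ_conjg.
have Nn : g * c^-1 \in 'N_H(P).
  rewrite inE groupM ?groupV //=; apply/normP.
  by rewrite conjsgM [P :^ g]defPg conjsgK.
have sylPN : p.-Sylow('N_H(P)) P.
  by rewrite (pHall_subl _ _ sylP) ?subsetIl // subsetI (pHall_sub sylP) normG.
have := subsetP (norm_cent_Sylow (pHall_sub sylP) (pHall_pgroup sylP) sylPN) _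
  Nn.
case/mulsgP=> d u /setIP[_ cPd] Pu def_n; exists u => //.
rewrite -cxg -conjgM def_n conjgM; congr (_ ^ _).
by apply/conjg_fixP/commgP/commute_sym/(centP cPd).
Qed.

(** For perfect H the transfer into P / P' is trivial. Control of fusion evaluates it at x in P as
    the class of x to the power |H : P|; this index is prime to p, so x would lie in P', although P'
    < P. *)
Lemma Frobenius_der1_proper : p %| #|H| -> prime p -> H^`(1) != H.
Proof.
move=> p_dv p_pr; have [P sylP] := Sylow_exists p H.
have sPH := pHall_sub sylP.
have ntP : P :!=: 1 by rewrite -rank_gt0 (rank_Sylow sylP) p_rank_gt0
  mem_primes p_pr cardG_gt0.
have := sol_der1_proper (pgroup_sol (pHall_pgroup sylP)) (subxx P) ntP.
case/properP=> sP'P [x Px notP'x]; apply: contra notP'x => /eqP perfH.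
pose alpha := restrm_morphism (der_norm 1 P) (coset_morphism P^`(1)).
have abP : abelian (alpha @* P).
  by rewrite morphim_restrm setIid; apply: sub_der1_abelian.
have abPP' : abelian (P / P^`(1)) by apply: sub_der1_abelian.
have Hx := subsetP sPH x Px.
have trx : transfer H abP x = 0%R.
  have sH'K : H \subset 'ker (transfer_morphism H abP).
    rewrite -{1}perfH; apply: der1_min; first exact: ker_norm.
    rewrite (isog_abelian (first_isog _)).
    by apply/centsP=> u _ v _; apply: GRing.addrC.
  exact: mker (subsetP sH'K x Hx).
have trX := transversalP (rcosets_cycle_partition sPH Hx).
set X := transversal _ _ in trX.
(* In the cycle expansion of the transfer, each conjugate of a power of x that falls in P is already
   P-conjugate to that power, so both have the same class modulo P'. *)
have fmx (y : gT) : y \in X ->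
   restrm (transfer_morph_subproof alpha) (FiniteModule.fmod abP \o alpha)
     (x ^+ #|<[x]> : P :* y| ^ y^-1)
   = (FiniteModule.fmod abP (alpha x) *+ #|<[x]> : (P :* y)%g|)%R.
  move=> Xy; have Hy := subsetP (transversal_sub trX) y Xy.
  set n := #|_ : _|; have Pxn : x ^+ n \in P by apply: groupX.
  have Pxny : x ^+ n ^ y^-1 \in P.
    by rewrite conjgE invgK mulgA -mem_rcoset mulg_exp_card_rcosets.
  have [u Pu ->] := Sylow_control_fusion sylP Pxn (groupVr Hy) Pxny.
  rewrite /= /restrm /=; have nP'P := subsetP (der_norm 1 P).
  rewrite -FiniteModule.fmodX; last by apply: mem_morphim.
  congr (FiniteModule.fmod _ _); rewrite morphJ ?nP'P // morphX ?nP'P //.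
  apply/conjg_fixP/commgP; apply: (centsP abPP'); rewrite ?groupX //;
    exact: mem_quotient.
have := transfer_cycle_expansion sPH abP Hx trX.
rewrite trx (eq_bigr _ fmx) GRing.sumrMnr (sum_index_rcosets_cycle sPH Hx trX).
have Pax : alpha x \in alpha @* P by apply: mem_morphim.
rewrite -FiniteModule.fmodX // => /(congr1 (@FiniteModule.fmval _ _ abP)).
rewrite FiniteModule.fmodK ?groupX //= => /esym/eqP;
  rewrite /restrm -order_dvdn => dv_ox.
apply: coset_idr; first exact: subsetP (der_norm 1 P) x Px.
apply/eqP; rewrite -order_eq1; apply/eqP/(@pnat_1 p).
  apply: morph_p_elt (mem_p_elt (pHall_pgroup sylP) Px).
  exact: subsetP (der_norm 1 P) x Px.
by case/and3P: sylP => _ _; apply: pnat_dvd.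
Qed.

End Frobenius.

(** * Action of p'-elements on p-groups *)

Section CriticalSubgroup.

Variables (gT : finGroupType) (p : nat) (G R : {group gT}).
Implicit Types (a b x : gT) (W : {group gT}).

(* This is O^p(G). *)
Definition p'_gen : {group gT} := <<[set x in G | p^'.-elt x]>>%G.
Local Notation O := p'_gen.

Lemma p'_gen_normal : O <| G.
Proof.
apply/andP; split; first by rewrite gen_subG; apply/subsetP=> x;
  rewrite inE => /andP[].
apply: norms_gen; apply/subsetP=> g Gg; rewrite inE;
  apply/subsetP=> y /imsetP[x].
by rewrite !inE => /andP[Gx px] ->{y}; rewrite groupJ // p_eltJ.
Qed.

Lemma mem_p'_gen x : x \in G -> p^'.-elt x -> x \in O.
Proof. by move=> Gx px; rewrite mem_gen // inE Gx. Qed.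

Lemma p'_gen_sub_cent (A : {set gT}) :
  (forall a x, a \in A -> x \in G -> p^'.-elt x -> commute a x) ->
    O \subset 'C(A).
Proof.
move=> cAx; rewrite gen_subG; apply/subsetP=> x; rewrite inE => /andP[Gx px].
by apply/centP=> a Aa; apply/commute_sym/cAx.
Qed.

Hypotheses (nsRG : R <| G) (pR : p.-group R).
Hypothesis not_cRO : ~~ (O \subset 'C(R)).
Hypothesis minR :
  forall W, W <| G -> W \subset R -> O \subset 'C(W) \/ W :=: R.

Local Notation T := 'C_R(O).

Let nsOG := p'_gen_normal.
Let nRO : O \subset 'N(R) := subset_trans (normal_sub nsOG) (normal_norm nsRG).

Lemma critical_normal W : W <| G -> W \subset R -> W \subset T \/ W :=: R.
Proof.
move=> nsWG sWR; have [cWO|] := minR nsWG sWR; last by right.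
by left; rewrite subsetI sWR centsC.
Qed.

(** If [[~: R, O]] were proper it would lie in T, so each [[~ a, x]] would be fixed by x;
    [coprime_comm_fixed] would then make O centralise R. *)
Lemma critical_comm : [~: R, O] = R.
Proof.
have nsROG : [~: R, O] <| G.
  rewrite /normal normsR ?normal_norm // andbT.
  by rewrite (subset_trans _ (normal_sub nsRG)) // commg_subl.
have sROR : [~: R, O] \subset R by rewrite commg_subl.
have [sROT | //] := critical_normal nsROG sROR.
case/negP: not_cRO; apply: p'_gen_sub_cent => a x Ra Gx px.
have Ox := mem_p'_gen Gx px.
have Tax : [~ a, x] \in T by rewrite (subsetP sROT) ?mem_commg.
have [Rax /centP cax] := setIP Tax.
exact: coprime_comm_fixed (mem_p_elt pR Rax) px (cax x Ox).
Qed.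

Lemma critical_cent_normal : T <| G.
Proof.
rewrite /normal (subset_trans (subsetIl _ _) (normal_sub nsRG)) /=.
by rewrite normsI ?norms_cent ?normal_norm.
Qed.

Lemma critical_Phi : 'Phi(R) \subset T.
Proof.
have nsPG : 'Phi(R) <| G by apply: gFnormal_trans.
have [// | PhiR] := critical_normal nsPG (Phi_sub R).
have ntR : R :!=: 1 by apply: contra not_cRO => /eqP->; apply: cents1.
by have := Phi_proper ntR; rewrite PhiR properxx.
Qed.

(** Three subgroups lemma with R = [[~: R, O]]: O centralises T, and also [[~: T, R]], which lies in
    the normal subgroup T. *)
Lemma critical_center : T \subset 'Z(R).
Proof.
rewrite subsetI subsetIl /= centsC; apply/commG1P.
rewrite -{1}critical_comm; apply: three_subgroup.
  suffices -> : [~: O, T] = 1 by rewrite comm1G.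
  by apply/commG1P; rewrite centsC subsetIr.
apply/commG1P; apply: subset_trans (subsetIr R _).
by rewrite commg_subl (subset_trans (normal_sub nsRG)) // normal_norm
  ?critical_cent_normal.
Qed.

Lemma critical_expp a : a \in R -> a ^+ p \in T.
Proof.
move=> Ra; apply: (subsetP critical_Phi); rewrite (Phi_joing pR).
apply: (subsetP (joing_subr _ _)).
exact: (Mho_p_elt 1) Ra (mem_p_elt pR Ra).
Qed.

Lemma critical_commg a b : a \in R -> b \in R -> [~ a, b] \in T.
Proof.
move=> Ra Rb; apply: (subsetP critical_Phi); rewrite (Phi_joing pR).
by apply: (subsetP (joing_subl _ _)); apply: mem_commg.
Qed.

Lemma critical_cent_commute a b : a \in T -> b \in R -> commute a b.
Proof. by move=> Ta Rb; have /setIP[_ /centP] := subsetP critical_center a Ta;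
  apply. Qed.

Lemma critical_commg_expp a b : a \in R -> b \in R -> [~ a, b] ^+ p = 1.
Proof.
move=> Ra Rb; have Tab := critical_commg Ra Rb.
rewrite -commXg; last exact/commute_sym/critical_cent_commute.
by apply/eqP/commgP/critical_cent_commute; first exact: critical_expp.
Qed.

(** Commutators in R are central of exponent dividing p, so p dividing 'C(e, 2) makes the e-th power
    map a morphism on R. Its values lie in T and are fixed by O, so it kills [[~: R, O]] = R. It
    serves for e = p odd, and for e = 4 when p = 2. *)
Lemma critical_exponent e a : p %| e -> p %| 'C(e, 2) -> a \in R -> a ^+ e = 1.
Proof.
move=> p_e p_e2 Ra.
have powM : {in R &, {morph (fun a => a ^+ e) : x y / x * y}}.
  move=> x y Rx Ry /=; have Tyx := critical_commg Ry Rx.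
  rewrite expMg_Rmul; try exact/commute_sym/critical_cent_commute.
  by case/dvdnP: p_e2 => k ->; rewrite mulnC expgM critical_commg_expp //
    expg1n mulg1.
suffices sRK : R \subset 'ker (Morphism powM) by apply: (mker (subsetP sRK a
  Ra)).
rewrite -{1}critical_comm gen_subG; apply/subsetP=> _ /imset2P[x o Rx Oo ->].
have Rxo : x ^ o \in R by rewrite memJ_norm // (subsetP nRO).
apply/kerP; first by rewrite commgEl groupM ?groupV.
rewrite commgEl morphM ?groupV // morphV //= -conjXg.
have /setIP[_ /centP cxe] : x ^+ e \in T.
  by case/dvdnP: p_e => k ->; rewrite mulnC expgM groupX ?critical_expp.
by rewrite conjgE cxe // mulKg mulVg.
Qed.

End CriticalSubgroup.

Section CriticalExists.

Variables (gT : finGroupType) (p : nat).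
Implicit Types (G P R W : {group gT}).

Lemma critical_exists G P :
  P <| G -> p.-group P -> ~~ (p'_gen p G \subset 'C(P)) ->
  exists R : {group gT}, [/\ R <| G, R \subset P, ~~ (p'_gen p G \subset 'C(R))
    & forall W, W <| G -> W \subset R -> p'_gen p G \subset 'C(W) \/ W :=: R].
Proof.
move=> nsPG pP not_cP.
pose gP := [pred R : {group gT} | (R <| G) && ~~ (p'_gen p G \subset 'C(R))].
have [|R /mingroupP[/andP[nsRG ncR] minR] sRP] := @mingroup_exists _ gP P.
  by rewrite /= nsPG.
exists R; split=> // W nsWG sWR; have [|ncW] := boolP (_ \subset 'C(W));
  first by left.
by right; apply: minR => //=; rewrite nsWG.
Qed.

Lemma odd_p'_commute G P :
  prime p -> odd p -> P <| G -> p.-group P ->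
  (forall a x, a \in P -> #[a] = p -> x \in G -> p^'.-elt x -> commute a x) ->
  p'_gen p G \subset 'C(P).
Proof.
move=> p_pr odd_p nsPG pP cPx; apply/idPn=> /(critical_exists nsPG pP).
case=> R [nsRG sRP ncR minR]; have /negP[] := ncR;
  apply: p'_gen_sub_cent => a x Ra Gx px.
have [-> | nta] := eqVneq a 1; first exact/commute_sym/commute1.
apply: cPx => //; first exact: (subsetP sRP).
apply/prime_nt_dvdP; rewrite ?order_eq1 // order_dvdn.
rewrite (critical_exponent nsRG (pgroupS sRP pP) ncR minR) // bin2odd //.
exact: dvdn_mulr.
Qed.

End CriticalExists.

(** * A quaternion section from two elements with the same square *)

Section Quaternion.

Variable gT : finGroupType.
Implicit Types (a b : gT) (P : {group gT}).

(** Modulo the central element z * w the commutator w becomes z, which turns [a ^ b] into [a^-1]: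
    the defining relations of Q_8 hold. As z != 1, w survives in the quotient, which is thus
    nonabelian and cannot have order at most 4. *)
Lemma Q8_quotient a b (z := a ^+ 2) (w := [~ a, b]) :
    b ^+ 2 = z -> z ^+ 2 = 1 -> z != 1 -> w ^+ 2 = 1 -> w != 1 ->
    commute a w -> commute b w ->
  <[z * w]> <| <[a]> <*> <[b]> /\ <[a]> <*> <[b]> / <[z * w]> \isog 'Q_8.
Proof.
move=> b2 z2 ntz w2 ntw caw cbw; set A := <[a]> <*> <[b]>; set M := <[z * w]>.
have caz : commute a z by apply: commuteX.
have cbz : commute b z by rewrite -b2; apply: commuteX.
have Aa : a \in A by rewrite mem_gen // inE cycle_id.
have Ab : b \in A by rewrite mem_gen // inE cycle_id orbT.
have AM : z * w \in A by rewrite groupM ?groupX // groupR.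
have cMA : A \subset 'C(M).
  rewrite cent_cycle join_subG !cycle_subG.
  by apply/andP; split; apply/cent1P/commuteM.
have nsMA : M <| A by rewrite /normal cycle_subG AM cents_norm.
have nMA := normal_norm nsMA.
have nMa := subsetP nMA a Aa; have nMb := subsetP nMA b Ab.
split=> //; have cwz : commute z w by apply/commute_sym/commuteX/commute_sym.
have zw2 : (z * w) ^+ 2 = 1 by rewrite expgMn // z2 w2 mulg1.
have notMw : w \notin M.
  have sM2 : M \subset [set 1; z * w].
    apply/subsetP=> _ /cycleP[k ->]; rewrite -[k]odd_double_half expgD -mul2n
      expgM zw2.
    by rewrite expg1n mulg1 !inE; case: odd; rewrite ?eqxx ?orbT.
  apply/negP=> /(subsetP sM2); rewrite !inE (negPf ntw) /=.
  by rewrite -{1}[w]mul1g (inj_eq (mulIg w)) eq_sym (negPf ntz).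
have isoQ : 'Q_(2 ^ 3) \isog Grp (x : y : x ^+ 4, y ^+ 2 = x ^+ 2, x ^ y =
  x^-1).
  exact: (@Grp_quaternion 3).
have homQ : A / M \homg 'Q_(2 ^ 3).
  rewrite isoQ; apply/existsP; exists (coset M a, coset M b) => /=.
  rewrite !xpair_eqE -!morphX // -morphJ // -morphV //= quotientY ?cycle_subG
    //.
  rewrite !quotient_cycle // eqxx /= (expgM a 2 2) z2 morph1 eqxx /= b2 eqxx /=.
  apply/eqP.
  have -> : a ^ b = a^-1 * (z * w) by rewrite conjg_mulR /z expgS !mulgA mulVg
    mul1g.
  by rewrite morphM ?groupV ?(subsetP nMA) //= [coset _ (z * w)]coset_id
    ?cycle_id // mulg1.
have [k le_k3 oAM] : exists2 k, k <= 3 & #|A / M| = (2 ^ k)%N.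
  by apply/dvdn_pfactor => //; rewrite -(@card_quaternion 3) // card_homg.
rewrite isogEcard (homQ : _ \homg 'Q_8) (@card_quaternion 3 _ : #|'Q_8| = (2 ^
  3)%N) //.
rewrite oAM leq_exp2l //= ltnNge; apply/negP=> le_k2.
have abAM : abelian (A / M).
  by apply: (@p2group_abelian _ 2); rewrite ?/pgroup /= oAM ?pnatX ?pfactorK.
case/negP: notMw; rewrite coset_idr ?(subsetP nMA) ?groupR //.
by rewrite morphR //; apply/eqP/commgP/(centsP abAM); apply: mem_quotient.
Qed.

End Quaternion.

(** * Orbits of p-power length and the partial Pi-property *)

Section TwoPowerOrbit.

Variable gT : finGroupType.
Implicit Types (G W : {group gT}) (a : gT).

(* A Sylow p-subgroup S is transitive on the conjugates of a, so that         *)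
(* [a, G] = [a, S] is contained in the proper subgroup [W, S] of W.           *)
Lemma minnormal_pindex_cent (p : nat) G W a :
  minnormal W G -> W \subset G -> p.-group W -> a \in W ->
  p.-nat #|G : 'C_G[a]| -> a \in 'Z(G).
Proof.
move=> /mingroupP[/andP[ntW nWG] minW] sWG pW Wa pGa.
have [S sylS] := Sylow_exists p G.
have sSG := pHall_sub sylS.
have sWS : W \subset S.
  by apply: subset_trans (pcore_sub_Hall sylS);
    rewrite pcore_max // /normal sWG.
have GCS : 'C_G[a] * S = G.
  apply: coprime_index_mulG; rewrite ?subsetIl //.
  by apply: pnat_coprime pGa _; case/and3P: sylS.
have ltWS : [~: W, S] \proper W.
  apply: nil_comm_properl (pgroup_nil (pHall_pgroup sylS)) sWS ntW _.
  by rewrite subsetI subxx (subset_trans sSG nWG).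
pose L := [~: [set a], G]%G.
have sLWS : L \subset [~: W, S].
  rewrite gen_subG; apply/subsetP=> _ /imset2P[_ g /set1P-> Gg ->].
  move: Gg; rewrite -{1}GCS => /mulsgP[c s /setIP[_ /cent1P cac] Ss ->].
  have -> : [~ a, c * s] = [~ a, s].
    by rewrite commgMJ (_ : [~ a, c] = 1) ?conj1g ?mulg1 //;
      apply/eqP/commgP/commute_sym.
  exact: mem_commg.
have L1 : L :=: 1.
  apply/eqP; apply: contraT => ntL; case/andP: ltWS => sWSW /negP[].
  rewrite -{1}(minW L) //; last exact: subset_trans sLWS sWSW.
  by rewrite ntL normsRr.
rewrite inE (subsetP sWG) //=; apply/centP=> g Gg; apply/commgP.
by rewrite -in_set1 -[[set 1]]L1 mem_commg ?set11.
Qed.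

End TwoPowerOrbit.

Section PartialPi.

Variable gT : finGroupType.
Implicit Types (G P R C U V : {group gT}) (a : gT).

(** U / V lies in P / V by minimality, so it is an elementary abelian 2-group and a has image of
    order 2. The normaliser of that image is its centraliser, of 2-power index, so
    [minnormal_pindex_cent] makes it central; by minimality it generates U / V. *)
Lemma Pi_chief_factor_central G P U V a :
    chief_factor G V U -> P <| G -> 2.-group P -> a \in P -> a \in U ->
      a \notin V ->
    \pi((<[a]> * V) / V :&: U / V).-nat
      #|G / V : 'N_(G / V)((<[a]> * V) / V :&: U / V)| ->
  [~: U, G] \subset V.
Proof.
move=> chUV nsPG pP Pa Ua notVa.
have minUV := chief_factor_minnormal chUV.
have /andP[/maxgroupP[/andP[/andP[sVU _] nVG] _] /andP[sUG nUG]] := chUV.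
have nVa : a \in 'N(V) by rewrite (subsetP nVG) // (subsetP sUG).
have Uva : coset V a \in U / V by rewrite mem_quotient.
have -> : (<[a]> * V) / V :&: U / V = <[coset V a]>.
  rewrite quotientMidr quotient_cycle //; apply/setIidPl.
  by rewrite cycle_subG.
have nta : coset V a != 1 by apply: contra notVa => /eqP/coset_idr->.
have /mingroupP[/andP[ntUV nUVG] minW] := minUV.
have pUV : 2.-group (U / V).
  have sUP : U / V :&: P / V = U / V.
    apply: (minW (U / V :&: P / V)%G (_ : _ && _) (subsetIl _ _)).
    apply/andP; split; last by apply: normsI nUVG _;
      apply/quotient_norms/normal_norm.
    apply: contraNneq nta => /= UP1; rewrite -in_set1 -[[set 1]]UP1 inE Uva.
    exact: mem_quotient.
  by rewrite -sUP (pgroupS (subsetIr _ _)) ?quotient_pgroup.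
have oa : #[coset V a] = 2.
  have [_ _ /is_abelemP[q q_pr abUV]] :=
    minnormal_solvable minUV (subxx _) (pgroup_sol pUV).
  have := pnatPpi (mem_p_elt pUV Uva); rewrite (abelem_order_p abUV Uva nta).
  by move/(_ q); rewrite pi_of_prime // inE eqxx => /(_ isT)/eqP.
have Ncent : 'N_(G / V)(<[coset V a]>) = 'C_(G / V)[coset V a].
  congr (_ :&: _); apply/eqP; rewrite eqEsubset -{2}cent_cycle cent_sub andbT.
  rewrite cycle2g //; apply/subsetP=> x /normP nx;
    apply/cent1P/commute_sym/commgP/conjg_fixP.
  have: coset V a ^ x \in [set 1; coset V a] :^ x by rewrite memJ_conjg !inE
    eqxx orbT.
  by rewrite nx !inE conjg_eq1 (negPf nta) => /eqP.
rewrite Ncent => pidx.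
have sUVG : U / V \subset G / V by apply: quotientS.
have Za : coset V a \in 'Z(G / V).
  apply: minnormal_pindex_cent minUV sUVG pUV Uva _ => //.
  apply: sub_in_pnat pidx => r _; rewrite /= -orderE oa pi_of_prime //.
rewrite -quotient_cents2 ?(subset_trans sUG) //.
suffices <- : <[coset V a]> = U / V by rewrite cycle_subG; case/setIP: Za.
apply: (minW <[coset V a]>%G); last by rewrite cycle_subG.
rewrite /= cycle_eq1 nta cents_norm // centsC cycle_subG.
by case/setIP: Za.
Qed.

Lemma partial_Pi_chief_factor G a :
  a \in G -> a != 1 -> partial_Pi G <[a]>%G ->
  exists U V : {group gT}, [/\ chief_factor G V U, a \in U, a \notin V
    & \pi((<[a]> * V) / V :&: U / V).-nat
      #|G / V : 'N_(G / V)((<[a]> * V) / V :&: U / V)|].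
Proof.
move=> Ga nta [s [/(pathP 1%G) chs lasts pis]].
pose inU := fun U : {group gT} => a \in U.
have has_s : has inU s.
  case: s lasts {chs pis} => [/= G1|U s' lasts].
    by rewrite -[G]G1 inE (negPf nta) in Ga.
  by apply/hasP; exists (last U s'); [apply: mem_last |
    rewrite /inU [last U s']lasts].
pose i := find inU s; have lt_i : i < size s by rewrite -has_find.
exists (nth 1%G s i), (nth 1%G (1%G :: s) i); split;
  [exact: chs | exact: (nth_find 1%G has_s) | | exact: pis].
case def_i: i => [|j] /=; first by rewrite inE.
by apply/negP=> aj; have := @before_find _ 1%G inU s j;
  rewrite -/i def_i ltnSn /inU aj => /(_ isT).
Qed.

End PartialPi.

(** * Action of elements of odd order on 2-groups *)

Section TwoGroups.

Variable gT : finGroupType.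
Implicit Types (G P R : {group gT}) (a : gT).

Lemma two_p'_commute G P :
    P <| G -> 2.-group P ->
    (forall a x, a \in P -> #[a] = 2 -> x \in G -> 2^'.-elt x -> commute a x) ->
    quaternion_free P \/
      (forall C : {group gT}, C \subset P -> cyclic C -> #|C| = 4 ->
        partial_Pi G C) ->
  p'_gen 2 G \subset 'C(P).
Proof.
move=> nsPG pP cPx hypP; apply/idPn=> /(critical_exists nsPG pP).
case=> R [nsRG sRP ncR minR]; have pR := pgroupS sRP pP.
have a4 a : a \in R -> a ^+ 4 = 1 by apply: (critical_exponent nsRG pR ncR
  minR).
have cRx a x : a \in R -> a ^+ 2 = 1 -> x \in G -> 2^'.-elt x -> commute a x.
  move=> Ra a2; have [-> *| nta] := eqVneq a 1;
    first exact/commute_sym/commute1.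
  apply: cPx; first exact: (subsetP sRP).
  by apply/prime_nt_dvdP; rewrite ?order_eq1 // order_dvdn a2.
have /existsP[a /existsP[x /and4P[Ra Gx px /commgP ncax]]] :
  [exists a, exists x, [&& a \in R, x \in G, 2^'.-elt x & [~ a, x] != 1]].
  apply: contraNT ncR => /existsPn noax; apply: p'_gen_sub_cent => a x Ra Gx px.
  have /existsPn/(_ x) := noax a; rewrite Ra Gx px /= negbK; exact: commgP.
have nta2 : a ^+ 2 != 1 by apply/eqP=> a2; apply/ncax/cRx.
case: hypP => [/forallP/(_ (<[a]> <*> <[a ^ x]>)%G) | PiP].
  have Ox := mem_p'_gen Gx px.
  have /setIP[_ /centP/(_ x Ox) cza] := critical_expp nsRG pR ncR minR Ra.
  have Rax : a ^ x \in R by rewrite memJ_norm // (subsetP (normal_norm nsRG)).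
  have w2 := critical_commg_expp nsRG pR ncR minR Ra Rax.
  have Tw := critical_commg nsRG pR ncR minR Ra Rax.
  have [|||||||nsM isoM] := @Q8_quotient _ a (a ^ x).
  - by rewrite -conjXg conjgE cza mulKg.
  - by rewrite -expgM a4.
  - by [].
  - exact: w2.
  (* If a commuted with [a ^ x], then [[~ a, x]] would square to 1, as x fixes [a ^+ 2]. It would
     then commute with x by [cRx], and so would a by [coprime_comm_fixed]. *)
  - apply/eqP=> /eqP/commgP caax; case: ncax.
    have Rac : [~ a, x] \in R by rewrite commgEl groupM ?groupV.
    apply: (coprime_comm_fixed (mem_p_elt pR Rac) px); apply: cRx => //.
    rewrite commgEl expgMn; last exact: commute_sym (commuteV (commute_sym
      caax)).
    by rewrite -conjXg expgVn conjgE cza mulKg mulVg.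
  - exact/commute_sym/(critical_cent_commute nsRG pR ncR minR).
  - exact/commute_sym/(critical_cent_commute nsRG pR ncR minR).
  move/forallP/(_ <[a ^+ 2 * [~ a, a ^ x]]>%G);
    rewrite isoM nsM andbT implybF => /negP[].
  by rewrite join_subG !cycle_subG !(subsetP sRP).
have oa : #[a] = 4.
  have: #[a] %| 2 ^ 2 by rewrite order_dvdn a4.
  case/dvdn_pfactor=> // k le_k2 oak; rewrite oak;
    case: k le_k2 oak => [|[|[|]]] // _ /eqP.
    by rewrite order_eq1 => /eqP a1; rewrite a1 expg1n eqxx in nta2.
  by move/eqP=> o2; rewrite -[2]o2 expg_order eqxx in nta2.
have Pa := subsetP sRP a Ra; have Ga := subsetP (normal_sub nsPG) a Pa.
have nta : a != 1 by apply: contra nta2 => /eqP->; rewrite expg1n.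
have := PiP <[a]>%G; rewrite cycle_subG cycle_cyclic -orderE oa =>
  /(_ Pa isT erefl).
case/(partial_Pi_chief_factor Ga nta)=> U [V [chUV Ua notVa piUV]].
have sUGV := Pi_chief_factor_central chUV nsPG pP Pa Ua notVa piUV.
have nsUG : U <| G by case/andP: chUV.
(* Centralising [R :&: U] would make x commute with a; otherwise R lies in U, and R = [[~: R, O]]
   falls into V, which misses a. *)
have [cRUO | RU] := minR (R :&: U)%G (normalI nsRG nsUG) (subsetIl _ _).
  case: ncax; apply/commute_sym; apply: (centP (subsetP cRUO x (mem_p'_gen Gx
    px))).
  by rewrite inE Ra.
case/negP: notVa; apply: (subsetP sUGV); apply: (subsetP _ a Ra).
rewrite -{1}(critical_comm nsRG pR ncR minR) commgSS ?(normal_sub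
  (p'_gen_normal _ _)) //.
by rewrite -RU subsetIr.
Qed.

End TwoGroups.

(** * Hypercentral generalized Fitting subgroups *)

Section Hypercentral.

Variable gT : finGroupType.
Implicit Types (G E H N : {group gT}) (x : gT).

(** For an odd prime p dividing |H|, [odd_p'_commute] gives Frobenius's condition on every
    p-subgroup, so H' < H; the hypothesis passes to H', and induction applies. With no such p, H is
    a 2-group. *)
Lemma odd_prime_hypercentral_sol H :
  (forall x, x \in H -> prime #[x] -> odd #[x] -> x \in hypercentre H) ->
  solvable H.
Proof.
have [n] := ubnP #|H|; elim: n H => // n IHn H /ltnSE-leHn hypH.
have [pH | ] := boolP (2.-group H); first exact: pgroup_sol pH.
rewrite /pgroup /pnat cardG_gt0 => /allPn[p].
rewrite mem_primes => /and3P[p_pr _ p_dv]; rewrite inE /= => p_neq2.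
have odd_p : odd p by case/even_prime: p_pr p_neq2 => // ->.
have p'_cent (D : {group gT}) x : D \subset H -> p.-group D -> x \in 'N_H(D) ->
    p^'.-elt x -> x \in 'C(D).
  move=> sDH pD Nx px; have nsDN : D <| 'N_H(D) by rewrite normal_subnorm.
  apply: (subsetP (odd_p'_commute p_pr odd_p nsDN pD _));
    last exact: mem_p'_gen.
  move=> a y Da oa /setIP[Hy _] py; have Ha := subsetP sDH a Da.
  apply: (hypercentre_commute (hypH a Ha _ _) _ Hy py); rewrite ?oa //.
  exact: mem_p_elt pD Da.
have H'neq := Frobenius_der1_proper p'_cent p_dv p_pr.
have sH'H := der_sub 1 H.
rewrite (series_sol (der_normal 1 H)) (abelian_sol (der_abelian 0 H)) andbT.
apply: IHn => [|x H'x x_pr x_odd].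
  by apply: leq_trans leHn; rewrite proper_card // properEneq H'neq.
apply: (subsetP (hypercentre_subgroup sH'H)).
by rewrite inE H'x andbT hypH // (subsetP sH'H).
Qed.

Lemma prime_hypercentral_quasinil_nil G N :
  N \subset G -> (forall x, x \in N -> prime #[x] -> x \in hypercentre G) ->
  quasinilpotent N -> nilpotent N.
Proof.
move=> sNG hypN; apply: solvable_quasinil_nil;
  apply: odd_prime_hypercentral_sol.
move=> x Nx x_pr _; apply: (subsetP (hypercentre_subgroup sNG)).
by rewrite inE Nx andbT hypN.
Qed.

(** A Sylow p-subgroup S of E centralises the hypercentral p'-group Q, so it lies in D. A p'-element
    of D centralises both Q and the p-core of F(E), hence lies in F(E) and commutes with S. So S is
    normal in D, thus is the p-core of D, a normal nilpotent subgroup of E. *)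
Lemma gen_Fitting_hypercentral E G :
  E <| G -> gen_Fitting E :=: 'F(E) -> 'F(E) \subset hypercentre G ->
  E \subset 'F(E).
Proof.
move=> nsEG defF sFZ; have sEG := normal_sub nsEG.
have sCF : 'C_E('F(E)) \subset 'F(E).
  by have := @cent_gen_Fitting _ E; rewrite defF => -> //;
    apply: Fitting_normal.
apply: all_Sylow_sub => p p_pr; have [S sylS] := Sylow_exists p E;
  exists S => //.
have pS := pHall_pgroup sylS; have sSE := pHall_sub sylS.
have nilF := Fitting_nil E.
pose Q := 'O_p^'('F(E)); pose D := 'C_E(Q)%G.
have nsQE : Q <| E by rewrite !gFnormal_trans.
have nsDE : D <| E.
  by rewrite /normal subsetIl normsI ?normG ?norms_cent ?normal_norm.
have commF pi y x : y \in 'F(E) -> pi.-elt y -> x \in E -> pi^'.-elt x ->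
  commute y x.
  move=> Fy py Ex px.
  exact: hypercentre_commute (subsetP sFZ y Fy) py (subsetP sEG x Ex) px.
have sSD : S \subset D.
  rewrite subsetI sSE; apply/centsP=> s Ss y Qy; apply/commute_sym.
  apply: (commF p^'); first exact: (subsetP (pcore_sub _ _)) Qy.
  - exact: mem_p_elt (pcore_pgroup _ _) Qy.
  - exact: (subsetP sSE).
  - by rewrite p_eltNK (mem_p_elt pS).
have D_F x : x \in D -> p^'.-elt x -> x \in 'F(E).
  case/setIP=> Ex cQx px; apply: (subsetP sCF); rewrite inE Ex /=.
  rewrite -(dprodW (nilpotent_pcoreC p nilF)) centM inE cQx andbT.
  apply/centP=> y Py; apply/commute_sym; apply: commF px => //.
    exact: (subsetP (pcore_sub _ _)) Py.
  exact: mem_p_elt (pcore_pgroup _ _) Py.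
have sylSD : p.-Sylow(D) S by rewrite (pHall_subl sSD (normal_sub nsDE)).
have nsSD : S <| D.
  rewrite /normal sSD; apply: all_Sylow_sub => q q_pr.
  have [-> | neq_qp] := eqVneq q p; first by exists S => //; apply: normG.
  have [T sylT] := Sylow_exists q D; exists T => //.
  apply: cents_norm; apply/centsP=> x Tx s Ss.
  have Dx := subsetP (pHall_sub sylT) x Tx.
  have px : p^'.-elt x.
    apply: sub_in_pnat (mem_p_elt (pHall_pgroup sylT) Tx) => r _ /eqP->.
    by rewrite !inE.
  apply: (commF p^') => //; first exact: D_F.
    exact: (subsetP sSE).
  by rewrite p_eltNK (mem_p_elt pS).
rewrite -(normal_Hall_pcore sylSD nsSD); apply: Fitting_max.
  exact: gFnormal_trans.
exact: pgroup_nil (pcore_pgroup _ _).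
Qed.

End Hypercentral.

Theorem corollary1p9 (FF : group_class) (gT : finGroupType)
    (G E : {group gT})
    (formF : formation FF)
    (satF : solubly_saturated FF)
    (nilF : contains_nilpotent FF)
    (nEG : E <| G)
    (FGE : FF (coset_of E) (G / E)%G)
    (prime_hyp : forall P : {group gT},
       P \subset gen_Fitting E -> prime #|P| -> P \subset hypercentre G)
    (four_hyp :
       (forall S : {group gT},
          2.-Sylow(gen_Fitting E) S -> ~~ quaternion_free S) ->
       forall C : {group gT},
         C \subset gen_Fitting E -> cyclic C -> #|C| = 4 -> partial_Pi G C) :
  FF gT G.
Proof.
have sEG := normal_sub nEG.
have hypF x : x \in gen_Fitting E -> prime #[x] -> x \in hypercentre G.
  by move=> Fx x_pr; have := prime_hyp <[x]>%G; rewrite !cycle_subG; apply.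
have defF : gen_Fitting E :=: 'F(E).
  apply: gen_Fitting_nil => N nsNE qN.
  have sNF := quasinil_sub_gen_Fitting nsNE qN.
  apply: (prime_hypercentral_quasinil_nil (subset_trans (normal_sub nsNE) sEG))
    qN.
  by move=> x Nx; apply: hypF; apply: (subsetP sNF).
have nsFG : 'F(E) <| G by apply: gFnormal_trans.
have sylF p : p.-Sylow('F(E)) 'O_p('F(E)) :=
  nilpotent_pcore_Hall p (Fitting_nil E).
have sFZ : 'F(E) \subset hypercentre G.
  apply: all_Sylow_sub => p p_pr; pose P := 'O_p('F(E))%G; exists P;
    first exact: sylF.
  have sPF : P \subset gen_Fitting E by rewrite defF pcore_sub.
  have nsPG : P <| G by apply: gFnormal_trans.
  have pP : p.-group P by apply: pcore_pgroup.
  have cPx a x : a \in P -> #[a] = p -> x \in G -> p^'.-elt x -> commute a x.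
    move=> Pa oa Gx px; apply: hypercentre_commute (mem_p_elt pP Pa) Gx px.
    by apply: hypF; rewrite ?oa // (subsetP sPF).
  suffices sOC : p'_gen p G \subset 'C(P).
    apply: normal_pgroup_hypercentre nsPG pP _ => // x Gx px.
    by rewrite (subsetP sOC) ?mem_p'_gen.
  have [p2 | odd_p] := even_prime p_pr; last exact: odd_p'_commute.
  rewrite p2 in cPx pP *; apply: two_p'_commute => //.
  (* Since F*(E) is nilpotent, P is its only Sylow 2-subgroup, so the premise of [four_hyp] amounts
     to P not being quaternion-free. *)
  have [qfP | not_qfP] := boolP (quaternion_free P); [by left | right=> C sCP].
  apply: four_hyp; last exact: subset_trans sCP sPF.
  move=> S sylS; suffices -> : S = P by [].
  rewrite defF -p2 in sylS; apply: val_inj; exact: eq_Hall_pcore (sylF p) sylS.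
apply: (formation_hypercentral_ext formF satF nilF nEG _ FGE).
exact: subset_trans (gen_Fitting_hypercentral nEG defF sFZ) sFZ.
Qed.
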